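(* Let $I^s_{g,\theta}$, $\kappa$, $\overline{\alpha}_1(\theta)$ and $\overline{\alpha}_2(\theta)$ be as defined in the context. Then $$\overline{\alpha}_1(\theta)\ge\overline{\alpha}_2(\theta),$$ and equality holds if and only if both equations $$\overline{\alpha}_1(\theta)=2^\kappa I^{\frac12}_{g,\theta}\quad\text{and}\quad 2^\kappa I^{\frac12}_{g,\theta}=\overline{\alpha}_2(\theta)$$ hold. Moreover, when $\kappa\le1$, the equality $\overline{\alpha}_1(\theta)=\overline{\alpha}_2(\theta)$ holds if and only if $\overline{\alpha}_1(\theta)=2^\kappa I^{\frac12}_{g,\theta}$.
   Context: $\Theta\subset\mathbb{R}$ is an open interval, $\{p_\theta\mid\theta\in\Theta\}$ is a family of probability densities with respect to a common reference measure, and $\theta\in\Theta$. For $0<s<1$, $I^s(p\|q):=-\log\int p^s(\omega)q^{1-s}(\omega)\,d\omega$ is the relative Rényi entropy. Standing assumptions: $g:[0,\infty)\to[0,\infty)$ is strictly monotonically increasing with $g(0)=0$ and has the same order as $I^s(p_\theta\|p_{\theta+\epsilon})$ as $\epsilon\to+0$; the finite limits $$I^s_{g,\theta}:=\lim_{\epsilon\to+0}\frac{I^s(p_{\theta-\epsilon/2}\|p_{\theta+\epsilon/2})}{g(\epsilon)}\qquad(0<s<1)$$ exist; and $\kappa>0$ is the real number such that $\lim_{\epsilon\to+0}g(x\epsilon)/g(\epsilon)=x^\kappa$ for all $x>0$ (this limit is assumed to exist). The function $s\mapsto I^s_{g,\theta}$ is concave and nonnegative on $(0,1)$. Definitions: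 $$\overline{\alpha}_1(\theta):=2^\kappa\sup_{0<s<1}I^s_{g,\theta},$$ $$\overline{\alpha}_2(\theta):=\begin{cases}\displaystyle\sup_{0<s<1}\frac{I^s_{g,\theta}}{s(1-s)}\left(s^{\frac{1}{\kappa-1}}+(1-s)^{\frac{1}{\kappa-1}}\right)^{\kappa-1}&\text{if }\kappa<1,\\[2mm] 2I^{\frac12}_{g,\theta}&\text{if }\kappa=1,\\[2mm] \displaystyle\inf_{0<s<1}\frac{I^s_{g,\theta}}{s(1-s)}\left(s^{\frac{1}{\kappa-1}}+(1-s)^{\frac{1}{\kappa-1}}\right)^{\kappa-1}&\text{if }\kappa>1.\end{cases}$$ *)

(* Defs.v *)
From HB Require Import structures.
From mathcomp Require Import all_boot all_order all_algebra.
From mathcomp Require Import all_classical all_reals all_analysis.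

Set Implicit Arguments.
Unset Strict Implicit.
Unset Printing Implicit Defensive.

Import Order.TTheory GRing.Theory Num.Theory.
Import numFieldNormedType.Exports.

Local Open Scope classical_set_scope.
Local Open Scope ring_scope.

Definition probability_density d (T : measurableType d) (R : realType)
    (mu : {measure set T -> \bar R}) (f : T -> R) : Prop :=
  [/\ measurable_fun setT f, forall x : T, 0 <= f x
    & (\int[mu]_x (f x)%:E = 1)%E].

(* Extended-real valued: the value is +oo when p and q have (mu-almost
   everywhere) disjoint supports, since lne 0 = -oo. *)
Definition renyi d (T : measurableType d) (R : realType)
    (mu : {measure set T -> \bar R}) (s : R) (p q : T -> R) : \bar R :=
  (- lne (\int[mu]_x (p x `^ s * q x `^ (1 - s))%:E))%E.

(* f and g are of the same order at 0+: each bounds the other up to a positive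
   constant factor near 0 (f may take infinite values away from 0). *)
Definition same_order_right0 (R : realType) (f : R -> \bar R) (g : R -> R) :
    Prop :=
  exists c C : R, [/\ 0 < c, 0 < C &
    \forall eps \near 0^'+,
      ((c * g eps)%:E <= f eps)%E /\ (f eps <= (C * g eps)%:E)%E].

(* In the next three definitions, I s stands for I^s_{g,theta}; only its values
   on ]0, 1[ are used. Suprema and infima are taken in \bar R. *)
Definition alpha1 (R : realType) (kappa : R) (I : R -> R) : \bar R :=
  ((2 `^ kappa)%:E * ereal_sup [set (I s)%:E | s in `]0%R, 1%R[%classic])%E.

Definition alpha2_fun (R : realType) (kappa : R) (I : R -> R) (s : R) : R :=
  I s / (s * (1 - s)) *
  (s `^ (1 / (kappa - 1)) + (1 - s) `^ (1 / (kappa - 1))) `^ (kappa - 1).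

Definition alpha2 (R : realType) (kappa : R) (I : R -> R) : \bar R :=
  if kappa < 1 then
    ereal_sup [set (alpha2_fun kappa I s)%:E | s in `]0, 1[%classic]
  else if kappa == 1 then (2 * I (1 / 2))%:E
  else ereal_inf [set (alpha2_fun kappa I s)%:E | s in `]0, 1[%classic].

(* Main.v *)
Require Import Defs.
From HB Require Import structures.
From mathcomp Require Import all_boot all_order all_algebra.
From mathcomp Require Import all_classical all_reals all_analysis.
From mathcomp Require Import measurable_realfun ring lra.

(** The entropies enter only through two properties of [s |-> I s] on ]0, 1[:
    it is nonnegative ([renyi_limit_ge0]) and concave ([renyi_limit_concave]).
    Both hold for the Renyi entropy itself by Hoelder's inequality, and pass to
    the limit after division by [g eps > 0].

    Dividing out [s (1 - s)] turns the expression inside [alpha2] into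
    [I s * weight kappa s] with
    [weight kappa s = (s `^ q + (1 - s) `^ q) `^ (kappa - 1)] and
    [q = 1 / (1 - kappa)].  This weight is symmetric about 1/2, where it
    equals [2 `^ kappa]; hence [2 `^ kappa * I (1 / 2)] is one of the values of
    which [alpha2] takes the supremum (kappa < 1) or the infimum (kappa > 1),
    and it is [alpha2] itself when kappa = 1.

    For kappa >= 1 this gives [alpha2 <= 2 `^ kappa * I (1 / 2) <= alpha1], so
    that equality of the extremes forces equality throughout.

    For kappa < 1 we have [q > 1], the weight has its strict maximum at 1/2 and
    decreases away from it ([weight_lt]); so [alpha2 <= alpha1], while
    [2 `^ kappa * I (1 / 2) <= alpha2].  The point that needs an argument is
    that [alpha1 = alpha2] implies [alpha1 = 2 `^ kappa * I (1 / 2)].  Let [M]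
    be the supremum of [I] and suppose [I (1 / 2) < M].  Near 1/2, concavity
    keeps [I s] close to [I (1 / 2)], thus away from [M]; far from 1/2, the
    weight stays away from [2 `^ kappa].  So [I s * weight kappa s] stays
    away from [2 `^ kappa * M], that is, [alpha2 < alpha1]
    ([weighted_concave_gap]). *)

Set Implicit Arguments.
Unset Strict Implicit.
Unset Printing Implicit Defensive.

Import Order.TTheory GRing.Theory Num.Theory.
Import numFieldNormedType.Exports.
Local Open Scope classical_set_scope.
Local Open Scope ring_scope.

(** * Nonnegativity and concavity of the Renyi entropy *)

(** Hoelder's inequality with exponents [1 / t] and [1 / (1 - t)], stated
    with integrals instead of norms.  Taking densities for [F] and [G] bounds
    the integral in the Renyi entropy by 1; taking the integrands at two
    orders gives the log-convexity of that integral in its order. *)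
Lemma integral_powR_hoelder (d : measure_display) (T : measurableType d)
    (R : realType) (mu : {measure set T -> \bar R}) (F G : T -> R) (t : R) :
  measurable_fun setT F -> measurable_fun setT G ->
  (forall x, 0 <= F x) -> (forall x, 0 <= G x) -> 0 < t < 1 ->
  (\int[mu]_x (F x `^ t * G x `^ (1 - t))%:E <=
   poweR (\int[mu]_x (F x)%:E) t * poweR (\int[mu]_x (G x)%:E) (1 - t))%E.
Proof.
move=> mF mG F0 G0 /andP[t0 t1].
have t1' : 0 < 1 - t by lra.
have := @hoelder _ _ _ mu (fun x => F x `^ t) (fun x => G x `^ (1 - t))
  t^-1 (1 - t)^-1.
rewrite !invrK !invr_gt0 => /(_ _ _ t0 t1')/=.
rewrite Lnorm1 !Lnorm.unlock /=.
rewrite !invrK.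
under eq_integral do rewrite ger0_norm ?mulr_ge0 ?powR_ge0//.
under [X in (_ <= poweR X _ * _)%E]eq_integral do
  rewrite ger0_norm ?powR_ge0// -powRrM mulfV ?gt_eqF// powRr1//.
under [X in (_ <= _ * poweR X _)%E]eq_integral do
  rewrite ger0_norm ?powR_ge0// -powRrM mulfV ?gt_eqF// powRr1//.
apply; last by ring.
- exact: (@measurableT_comp _ _ _ _ _ _ (@powR R ^~ t)).
- exact: (@measurableT_comp _ _ _ _ _ _ (@powR R ^~ (1 - t))).
Qed.

Lemma measurable_renyi_integrand (d : measure_display) (T : measurableType d)
    (R : realType) (p q : T -> R) (s : R) :
  measurable_fun setT p -> measurable_fun setT q ->
  measurable_fun setT (fun x => p x `^ s * q x `^ (1 - s)).
Proof.
move=> mp mq; apply: measurable_funM.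
- exact: (@measurableT_comp _ _ _ _ _ _ (@powR R ^~ s)).
- exact: (@measurableT_comp _ _ _ _ _ _ (@powR R ^~ (1 - s))).
Qed.

Lemma renyi_ge0 (d : measure_display) (T : measurableType d)
    (R : realType) (mu : {measure set T -> \bar R}) (p q : T -> R) (s : R) :
  probability_density mu p -> probability_density mu q -> 0 < s < 1 ->
  (0 <= renyi mu s p q)%E.
Proof.
move=> [mp p0 p1] [mq q0 q1] s01.
rewrite /renyi oppe_ge0 lne_le0.
by rewrite (le_trans (integral_powR_hoelder _ mp mq p0 q0 s01))// p1 q1
  !poweR1r mule1.
Qed.

(** The integrand at a convex combination of two orders is the product of the
    integrands at these orders, raised to the powers [t] and [1 - t].
    Finiteness makes both integrals positive reals, so that Hoelder's
    inequality can be read through [ln]. *)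
Lemma renyi_concave (d : measure_display) (T : measurableType d)
    (R : realType) (mu : {measure set T -> \bar R}) (p q : T -> R)
    (a b t : R) :
  probability_density mu p -> probability_density mu q ->
  0 < a < 1 -> 0 < b < 1 -> 0 < t < 1 ->
  renyi mu a p q \is a fin_num -> renyi mu b p q \is a fin_num ->
  (t%:E * renyi mu a p q + (1 - t)%:E * renyi mu b p q <=
   renyi mu (t * a + (1 - t) * b) p q)%E.
Proof.
move=> [mp p0 _] [mq q0 _] /andP[a0 a1] /andP[b0 b1] t01.
have /andP[t0 t1] := t01.
pose F s := fun x => p x `^ s * q x `^ (1 - s).
have mF s : measurable_fun setT (F s) by exact: measurable_renyi_integrand.
have F0 s x : 0 <= F s x by rewrite mulr_ge0 ?powR_ge0.
have powRDp x y r : 0 < x -> 0 < y -> 0 <= r -> r `^ (x + y) = r `^ x * r `^ y.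
  by move=> x0 y0 r0; rewrite powRD//; apply/implyP => /eqP; lra.
have FE x : F (t * a + (1 - t) * b) x = F a x `^ t * F b x `^ (1 - t).
  rewrite /F !powRM ?powR_ge0// -!powRrM.
  rewrite (_ : 1 - (t * a + _) = (1 - a) * t + (1 - b) * (1 - t)); last by ring.
  rewrite (mulrC t) (mulrC (1 - t)).
  by rewrite !powRDp ?mulr_gt0 ?subr_gt0// mulrACA.
have := integral_powR_hoelder mu (mF a) (mF b) (F0 a) (F0 b) t01.
under eq_integral do rewrite -FE.
rewrite /renyi -/(F a) -/(F b) -/(F (t * a + (1 - t) * b)).
have fin s : (- lne (\int[mu]_x (F s x)%:E))%E \is a fin_num ->
    exists2 r : R, 0 < r & (\int[mu]_x (F s x)%:E)%E = r%:E.
  case: (\int[mu]_x (F s x)%:E)%E => [r| |]//=.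
  by case: leP => // r0 _; exists r.
move=> + /fin[A A0 EA] /fin[B B0 EB].
rewrite EA EB !poweR_EFin -EFinM => le.
rewrite !lne_EFin// -!EFinN -!EFinM -EFinD leeNr -EFinN.
have -> : - (t * - ln A + (1 - t) * - ln B) = ln (A `^ t * B `^ (1 - t)).
  by rewrite lnM ?posrE ?powR_gt0// !ln_powR; ring.
rewrite -lne_EFin ?mulr_gt0 ?powR_gt0// lee_lne// in_itv/= leey andbT.
  by apply: integral_ge0 => x _; rewrite lee_fin F0.
by rewrite lee_fin mulr_ge0 ?powR_ge0.
Qed.

(** * The weight of the second coefficient *)

Lemma ln_ltB1 (R : realType) (v : R) : 0 < v -> v != 1 -> ln v < v - 1.
Proof.
move=> v0 v1; have := @expR_gt1Dx R (ln v); rewrite ln_eq0// => /(_ v1).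
by rewrite lnK ?posrE//; lra.
Qed.

(** With [y = 1 + q (b - 1)], the number [b] is the weighted mean
    [y / q + (1 - 1 / q) * 1]; the claim is the strict concavity of [ln] at this
    mean, obtained from the tangent bound [ln v <= v - 1] at [y / b] and at
    [1 / b]. *)
Lemma bernoulli_lt (R : realType) (q b : R) :
  1 < q -> 0 < b -> b != 1 -> 1 + q * (b - 1) < b `^ q.
Proof.
move=> q1 b0 bN1; set y := 1 + _.
have [y0|y0] := leP y 0; first by rewrite (le_lt_trans y0)// powR_gt0.
rewrite -ltr_ln ?posrE ?powR_gt0// ln_powR.
have h1 : ln y - ln b <= y / b - 1.
  rewrite -ln_div ?posrE//; have [->|yb] := eqVneq (y / b) 1.
    by rewrite ln1 subrr.
  by rewrite ltW// ln_ltB1// divr_gt0.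
have h2 : - ln b < b^-1 - 1.
  by rewrite -lnV ?posrE// ln_ltB1 ?invr_gt0// invr_eq1.
have h3 : (q - 1) * - ln b < (q - 1) * (b^-1 - 1) by rewrite ltr_pM2l// subr_gt0.
have h4 : y / b - 1 + (q - 1) * (b^-1 - 1) = 0.
  by rewrite /y; field; rewrite gt_eqF.
lra.
Qed.

Lemma powR_tangent_lt (R : realType) (q a t : R) :
  1 < q -> 0 < a -> 0 < t -> t != a -> a `^ q + q * a `^ (q - 1) * (t - a) < t `^ q.
Proof.
move=> q1 a0 t0 ta.
have aE : a `^ q = a `^ (q - 1) * a.
  by rewrite powRB ?powRr1 ?(ltW a0) ?divfK ?gt_eqF// implybT.
have := @bernoulli_lt R q (t / a) q1 (divr_gt0 t0 a0).
rewrite -subr_eq0 (_ : t / a - 1 = (t - a) / a); last by field; rewrite gt_eqF.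
rewrite mulf_neq0 ?invr_neq0 ?subr_eq0 ?(gt_eqF a0)// => /(_ isT).
rewrite -(ltr_pM2l (powR_gt0 q a0)) -powRM ?(ltW a0) ?divr_ge0 ?(ltW a0) ?(ltW t0)//.
rewrite (_ : a * (t / a) = t); last by field; rewrite gt_eqF.
by apply: le_lt_trans; rewrite le_eqVlt; apply/orP; left; apply/eqP;
  rewrite aE; field; rewrite gt_eqF.
Qed.

(** Tangent lines of [t |-> t `^ q] at [u] and at [1 - u]: the slopes have
    opposite contributions, and the one at [u] is the larger. *)
Lemma powR_symm_sum_lt (R : realType) (q u x : R) :
  1 < q -> 2^-1 <= u -> u < x -> x < 1 ->
  u `^ q + (1 - u) `^ q < x `^ q + (1 - x) `^ q.
Proof.
move=> q1 u2 ux x1.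
have h1 : u `^ q + q * u `^ (q - 1) * (x - u) < x `^ q.
  by apply: powR_tangent_lt => //; [lra|lra|rewrite gt_eqF].
have h2 : (1 - u) `^ q + q * (1 - u) `^ (q - 1) * (1 - x - (1 - u)) < (1 - x) `^ q.
  apply: powR_tangent_lt => //; [lra|lra|rewrite lt_eqF//; lra].
have h3 : (1 - u) `^ (q - 1) <= u `^ (q - 1).
  by apply: ge0_ler_powR; rewrite ?nnegrE; lra.
have h4 : 0 <= q * (x - u) * (u `^ (q - 1) - (1 - u) `^ (q - 1)).
  by rewrite !mulr_ge0//; lra.
lra.
Qed.

(** The factor [(s^r + (1-s)^r)^(kappa-1) / (s (1-s))], [r = 1 / (kappa - 1)],
    of [alpha2_fun], with [s (1 - s)] absorbed into the power: for kappa < 1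
    the exponent [- r] exceeds 1, so the inner sum is convex in [s]. *)
Definition weight {R : realType} (kappa s : R) : R :=
  (s `^ (- (1 / (kappa - 1))) + (1 - s) `^ (- (1 / (kappa - 1))))
    `^ (kappa - 1).

Lemma alpha2_funE (R : realType) (kappa : R) (I : R -> R) (s : R) :
  kappa != 1 -> 0 < s < 1 -> alpha2_fun kappa I s = I s * weight kappa s.
Proof.
move=> k1 /andP[s0 s1]; rewrite /alpha2_fun /weight.
have s1' : 0 < 1 - s by lra.
set r := 1 / (kappa - 1).
have rk : r * (kappa - 1) = 1 by rewrite /r mul1r mulVf// subr_eq0.
have ss : 0 < s * (1 - s) by rewrite mulr_gt0.
have -> : s `^ r + (1 - s) `^ r =
    (s * (1 - s)) `^ r * (s `^ (- r) + (1 - s) `^ (- r)).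
  rewrite powRM ?ltW// !powRN; field.
  by rewrite !gt_eqF// powR_gt0.
rewrite powRM ?addr_ge0 ?powR_ge0// -powRrM rk powRr1 ?ltW//.
by field; rewrite !gt_eqF.
Qed.

Lemma weight_half (R : realType) (kappa : R) :
  kappa != 1 -> weight kappa 2^-1 = 2 `^ kappa.
Proof.
move=> k1; rewrite /weight; set r := 1 / (kappa - 1).
have rk : r * (kappa - 1) = 1 by rewrite /r mul1r mulVf// subr_eq0.
rewrite (_ : 1 - 2^-1 = 2^-1 :> R); last by field.
have -> : 2^-1 `^ (- r) = 2 `^ r :> R.
  by rewrite -powR_inv1// -powRrM mulN1r opprK.
have -> : 2 `^ r + 2 `^ r = 2 `^ (r + 1) :> R.
  by rewrite powRD ?pnatr_eq0 ?implybT// powRr1// mulr_natr mulr2n.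
by rewrite -powRrM mulrDl rk mul1r addrC subrK.
Qed.

(** The outer exponent [kappa - 1] is negative, so it reverses the monotonicity
    of the convex sum inside. *)
Lemma weight_lt (R : realType) (kappa u x : R) :
  0 < kappa < 1 -> 2^-1 <= u -> u < x -> x < 1 -> weight kappa x < weight kappa u.
Proof.
move=> /andP[k0 k1] u2 ux x1; rewrite /weight.
set q := - (1 / (kappa - 1)).
have q1 : 1 < q.
  rewrite /q -mulrN -invrN mul1r opprB invf_gt1 ?subr_gt0//; lra.
clearbody q; have pos (z : R) : 0 < z -> 0 < z `^ q + (1 - z) `^ q.
  by move=> z0; rewrite ltr_pwDl ?powR_gt0 ?powR_ge0.
have posu : 0 < u `^ q + (1 - u) `^ q by apply: pos; lra.
have posx : 0 < x `^ q + (1 - x) `^ q by apply: pos; lra.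
rewrite -(opprB 1 kappa) (powRN (u `^ q + _)) (powRN (x `^ q + _)).
rewrite ltf_pV2 ?posrE ?powR_gt0//.
apply: gt0_ltr_powR; rewrite ?subr_gt0 ?nnegrE ?(ltW posu) ?(ltW posx)//.
exact: powR_symm_sum_lt.
Qed.

Lemma weight_sym (R : realType) (kappa s : R) :
  weight kappa (1 - s) = weight kappa s.
Proof. by rewrite /weight addrC (_ : 1 - (1 - s) = s)//; ring. Qed.

(** * Concave functions against the weight *)

Definition concave01 {R : realType} (I : R -> R) : Prop :=
  forall a b t : R, 0 < a < 1 -> 0 < b < 1 -> 0 < t < 1 ->
    t * I a + (1 - t) * I b <= I (t * a + (1 - t) * b).

Lemma weight_le_half (R : realType) (kappa s : R) :
  0 < kappa < 1 -> 0 < s < 1 -> weight kappa s <= 2 `^ kappa.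
Proof.
move=> /[dup] /andP[_ k1] k01 /andP[s0 s1].
rewrite -(weight_half (negbT (lt_eqF k1))).
have [->//|/lt_total/orP[s2|s2]] := eqVneq s 2^-1.
  by rewrite -weight_sym ltW// weight_lt//; lra.
by rewrite ltW// weight_lt//; lra.
Qed.

(** Effective continuity at 1/2: for [s < 1/2], the point 1/2 lies on the
    segment from [s] to 3/4, with coefficient [1 / (1 + 4 (1/2 - s))] on [s],
    and the value at 3/4 is dropped since it is nonnegative. *)
Lemma concave01_le_half (R : realType) (I : R -> R) (s : R) :
  (forall x, 0 < x < 1 -> 0 <= I x) -> concave01 I -> 0 < s < 1 ->
  I s <= (1 + 4 * `|s - 2^-1|) * I 2^-1.
Proof.
have left (J : R -> R) x : (forall x, 0 < x < 1 -> 0 <= J x) -> concave01 J ->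
    0 < x -> x < 2^-1 -> J x <= (1 + 4 * (2^-1 - x)) * J 2^-1.
  move=> J0 cJ x0 x2; set c := 1 + _.
  have c1 : 1 < c by rewrite /c; lra.
  have c0 : 0 < c by lra.
  have ci : 0 < c^-1 < 1 by rewrite invr_gt0 c0 invf_lt1.
  have := cJ x (3 / 4) c^-1 _ _ ci.
  rewrite (_ : c^-1 * x + _ = 2^-1); last first.
    by rewrite /c; field; rewrite /c in c0; rewrite gt_eqF//; lra.
  have J34 : 0 <= (1 - c^-1) * J (3 / 4) by rewrite mulr_ge0 ?J0//; lra.
  move=> h; rewrite -ler_pdivrMl//; apply: le_trans (h _ _); lra.
move=> I0 cI /andP[s0 s1].
have [s2|s2|->] := ltgtP s 2^-1; last first.
- by rewrite subrr normr0 mulr0 addr0 mul1r.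
(* The reflection of [I] about 1/2 reduces [s > 1/2] to the other side. *)
- have := left (fun x => I (1 - x)) (1 - s).
  rewrite (_ : 1 - (1 - s) = s); last by ring.
  rewrite (_ : 1 - 2^-1 = 2^-1 :> R); last by field.
  rewrite (_ : 2^-1 - (1 - s) = s - 2^-1); last by field.
  rewrite gtr0_norm ?subr_gt0//; apply.
  + by move=> x x01; apply: I0; lra.
  + move=> a b t a01 b01 t01.
    rewrite (_ : 1 - (t * a + (1 - t) * b) = t * (1 - a) + (1 - t) * (1 - b)).
      by apply: cI => //; lra.
    by ring.
  + lra.
  + lra.
- by rewrite ltr0_norm ?subr_lt0// opprB left.
Qed.

(** Splitting at distance [e] from 1/2: within it, [I] is bounded by
    the midpoint of [I (1 / 2)] and [M]; beyond it, the weight is bounded by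
    its value at distance [e], which is less than [2 `^ kappa]. *)
Lemma weighted_concave_gap (R : realType) (kappa M : R) (I : R -> R) :
  0 < kappa < 1 -> (forall x, 0 < x < 1 -> 0 <= I x) -> concave01 I ->
  (forall x, 0 < x < 1 -> I x <= M) -> I 2^-1 < M -> M <= 3 * I 2^-1 ->
  exists2 c, c < 2 `^ kappa * M &
    forall s, 0 < s < 1 -> I s * weight kappa s <= c.
Proof.
move=> k01 I0 cI IM ltM M3.
have K0 : (0 : R) < 2 `^ kappa by rewrite powR_gt0.
have I20 : 0 < I 2^-1 by lra.
have M0 : 0 < M by lra.
(* The distance at which the bound [concave01_le_half] reaches the midpoint. *)
set e := (M - I 2^-1) / (8 * I 2^-1).
have e0 : 0 < e by rewrite divr_gt0//; lra.
(* This is where [M <= 3 * I (1 / 2)] serves: [1/2 + e] stays in ]0, 1[. *)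
have e4 : e <= 4^-1 by rewrite /e ler_pdivrMr ?mulr_gt0//; lra.
have eE : (1 + 4 * e) * I 2^-1 = (M + I 2^-1) / 2.
  by rewrite /e; field; rewrite gt_eqF.
set w := weight kappa (2^-1 + e).
have w_lt : w < 2 `^ kappa.
  have /andP[_ k1] := k01.
  by rewrite -(weight_half (negbT (lt_eqF k1))) weight_lt//; lra.
exists (Num.max (2 `^ kappa * ((M + I 2^-1) / 2)) (w * M)).
  by rewrite gt_max ltr_pM2l// ltr_pM2r// w_lt andbT; lra.
move=> s s01; have /andP[s0 s1] := s01; rewrite le_max.
have [se|se] := leP `|s - 2^-1| e; apply/orP; [left|right].
  rewrite mulrC; apply: ler_pM;
    [exact: powR_ge0|exact: I0|exact: weight_le_half|].
  rewrite -eE (le_trans (concave01_le_half I0 cI s01))//.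
  by rewrite ler_pM2r//; lra.
rewrite mulrC; apply: ler_pM; [exact: powR_ge0|exact: I0| |exact: IM].
have [s2|s2] := leP s 2^-1.
  move: se; rewrite ler0_norm; last lra; move=> se.
  by rewrite -weight_sym ltW// weight_lt//; lra.
move: se; rewrite gtr0_norm; last lra; move=> se.
by rewrite ltW// weight_lt//; lra.
Qed.

(** The constant 3: every [s] is within 1/2 of 1/2, and [1 + 4 * (1 / 2) = 3] in
    [concave01_le_half]. *)
Lemma ereal_sup_concave01 (R : realType) (I : R -> R) :
  (forall x, 0 < x < 1 -> 0 <= I x) -> concave01 I ->
  exists M : R, [/\ ereal_sup [set (I s)%:E | s in `]0, 1[] = M%:E,
    (forall x, 0 < x < 1 -> I x <= M) & M <= 3 * I 2^-1].
Proof.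
move=> I0 cI; set S := ereal_sup _.
have half01 : 0 < (2^-1 : R) < 1 by lra.
have ub x : 0 < x < 1 -> ((I x)%:E <= S)%E.
  by move=> x01; apply: ereal_sup_ubound; exists x => //=; rewrite in_itv.
have S3 : (S <= (3 * I 2^-1)%:E)%E.
  apply: ge_ereal_sup => _ [s /= + <-]; rewrite in_itv/= => s01.
  rewrite lee_fin (le_trans (concave01_le_half I0 cI s01))//.
  rewrite ler_wpM2r ?I0//.
  have : `|s - 2^-1| <= 2^-1 by rewrite ler_norml; lra.
  lra.
case: S ub S3 => [M| |] ub S3.
- by exists M; split=> // x /ub.
- by move: S3; rewrite leye_eq.
- by have := ub _ half01.
Qed.

(** * Comparison of the two coefficients *)

(** Both equivalences of the theorem follow formally from these clauses.  The
    third is the rigidity: immediate from the chain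
    [alpha2 <= 2 `^ kappa * I (1 / 2) <= alpha1] when kappa >= 1, and
    [weighted_concave_gap] when kappa < 1. *)
Lemma alpha_comparison (R : realType) (kappa : R) (I : R -> R) :
  (forall x, 0 < x < 1 -> 0 <= I x) -> concave01 I -> 0 < kappa ->
  [/\ (alpha2 kappa I <= alpha1 kappa I)%E,
      kappa <= 1 -> ((2 `^ kappa * I 2^-1)%:E <= alpha2 kappa I)%E &
      alpha1 kappa I = alpha2 kappa I ->
        alpha1 kappa I = (2 `^ kappa * I 2^-1)%:E].
Proof.
move=> I0 cI k0.
have [M [SE IM M3]] := ereal_sup_concave01 I0 cI.
have half01 : 0 < (2^-1 : R) < 1 by lra.
have K0 : (0 : R) < 2 `^ kappa by rewrite powR_gt0.
have a1E : alpha1 kappa I = (2 `^ kappa * M)%:E by rewrite /alpha1 SE.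
have ge1 : ((2 `^ kappa * I 2^-1)%:E <= alpha1 kappa I)%E.
  by rewrite a1E lee_fin ler_pM2l// IM.
have halfE : kappa != 1 -> alpha2_fun kappa I 2^-1 = 2 `^ kappa * I 2^-1.
  by move=> k1; rewrite alpha2_funE// weight_half// mulrC.
have lek : 1 <= kappa -> (alpha2 kappa I <= (2 `^ kappa * I 2^-1)%:E)%E.
  rewrite /alpha2 leNgt => /negbTE ->; case: eqVneq => [->|k1].
    by rewrite powRr1// div1r.
  rewrite -halfE//; apply: ereal_inf_lbound.
  by exists 2^-1 => //=; rewrite in_itv.
have gek : kappa <= 1 -> ((2 `^ kappa * I 2^-1)%:E <= alpha2 kappa I)%E.
  rewrite /alpha2 le_eqVlt => /orP[/eqP->|k1].
    by rewrite ltxx eqxx powRr1// div1r.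
  rewrite k1 -halfE ?lt_eqF//; apply: ereal_sup_ubound.
  by exists 2^-1 => //=; rewrite in_itv.
have [k1|k1] := leP 1 kappa.
  have le2 := lek k1; split=> //; first exact: le_trans le2 ge1.
  by move=> a12; apply/eqP; rewrite eq_le ge1 andbT a12.
have k01 : 0 < kappa < 1 by rewrite k0.
have a2E c : (forall s, 0 < s < 1 -> I s * weight kappa s <= c) ->
    (alpha2 kappa I <= c%:E)%E.
  move=> Ic; rewrite /alpha2 k1; apply: ge_ereal_sup => _ [s /= + <-].
  by rewrite in_itv/= => s01; rewrite lee_fin alpha2_funE ?lt_eqF// Ic.
split=> //.
  rewrite a1E; apply: a2E => s s01.
  rewrite mulrC; apply: ler_pM;
    [exact: powR_ge0|exact: I0|exact: weight_le_half|exact: IM].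
move=> a12; have := IM _ half01; rewrite le_eqVlt => /orP[/eqP->|ltM] //.
have [c cM /a2E] := weighted_concave_gap k01 I0 cI IM ltM M3.
by rewrite -a12 a1E lee_fin leNgt cM.
Qed.

(** * Passage to the limit *)

Lemma renyi_limit_ge0 (d : measure_display) (T : measurableType d) (R : realType)
    (mu : {measure set T -> \bar R}) (P Q : R -> T -> R) (g : R -> R)
    (s l : R) :
  (\forall eps \near 0^'+,
    probability_density mu (P eps) /\ probability_density mu (Q eps)) ->
  (\forall eps \near 0^'+, 0 < g eps) -> 0 < s < 1 ->
  (renyi mu s (P eps) (Q eps) / (g eps)%:E)%E @[eps --> 0^'+] --> l%:E ->
  0 <= l.
Proof.
move=> dens g0 s01 lim; rewrite -lee_fin; apply: (cvge_to_ge lim).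
near=> eps; have [dP dQ] : probability_density mu (P eps) /\
  probability_density mu (Q eps) by near: eps.
rewrite mule_ge0 ?renyi_ge0// inver gt_eqF; last by near: eps.
by rewrite lee_fin invr_ge0 ltW//; near: eps.
Unshelve. all: by end_near. Qed.

(** A finite limit forces the quotients, hence the entropies, to be eventually
    finite, which makes the concavity of the Renyi entropy applicable. *)
Lemma renyi_limit_concave (d : measure_display) (T : measurableType d)
    (R : realType) (mu : {measure set T -> \bar R}) (P Q : R -> T -> R)
    (g I : R -> R) :
  (\forall eps \near 0^'+,
    probability_density mu (P eps) /\ probability_density mu (Q eps)) ->
  (\forall eps \near 0^'+, 0 < g eps) ->
  (forall s : R, 0 < s < 1 ->
    (renyi mu s (P eps) (Q eps) / (g eps)%:E)%E @[eps --> 0^'+] --> (I s)%:E) ->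
  concave01 I.
Proof.
move=> dens g0 lim a b t a01 b01 t01.
have m01 : 0 < t * a + (1 - t) * b < 1.
  move: a01 b01 t01 => /andP[a0 a1] /andP[b0 b1] /andP[t0 t1]; apply/andP; split; nra.
have /fine_cvgP[fa ca] := lim _ a01.
have /fine_cvgP[fb cb] := lim _ b01.
have /fine_cvgP[fm cm] := lim _ m01.
have div_fin (x : \bar R) (y : R) : 0 < y -> (x / y%:E)%E \is a fin_num ->
    exists2 r, x = r%:E & fine (x / y%:E)%E = r / y.
  move=> y0; rewrite inver gt_eqF//; case: x => [r| |].
  - by exists r.
  - by rewrite gt0_mulye ?lte_fin ?invr_gt0.
  - by rewrite gt0_mulNye ?lte_fin ?invr_gt0.
apply: (@ler_cvg_to _ _ _ _ _ _ _ _
  (cvgD (cvgM (cvg_cst t) ca) (cvgM (cvg_cst (1 - t)) cb)) cm).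
apply: filterS3 dens g0 (filterI fa (filterI fb fm)).
move=> eps [dP dQ] ge0 [fina [finb finm]].
have [ra Ea Fa] := div_fin _ _ ge0 fina.
have [rb Eb Fb] := div_fin _ _ ge0 finb.
have [rm Em Fm] := div_fin _ _ ge0 finm.
have : t * (ra / g eps) + (1 - t) * (rb / g eps) <= rm / g eps; last first.
  by rewrite -Fa -Fb -Fm.
rewrite !mulrA -mulrDl ler_pM2r ?invr_gt0//.
rewrite -lee_fin EFinD !EFinM -Ea -Eb -Em.
by apply: renyi_concave; rewrite ?Ea ?Eb.
Qed.

Theorem theorem3 (d : measure_display) (T : measurableType d) (R : realType)
    (mu : {measure set T -> \bar R})
    (Theta : set R) (Theta_open : open Theta) (Theta_itv : is_interval Theta)
    (p : R -> T -> R)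
    (p_density : forall t : R, Theta t -> probability_density mu (p t))
    (theta : R) (theta_in : Theta theta)
    (g : R -> R)
    (g_ge0 : forall x : R, 0 <= x -> 0 <= g x)
    (g_incr : forall x y : R, 0 <= x -> x < y -> g x < g y)
    (g0 : g 0 = 0)
    (g_order : forall s : R, 0 < s < 1 ->
      same_order_right0 (fun eps => renyi mu s (p theta) (p (theta + eps))) g)
    (I : R -> R)
    (I_lim : forall s : R, 0 < s < 1 ->
      (renyi mu s (p (theta - eps / 2)%R) (p (theta + eps / 2)%R)
         / (g eps)%:E)%E @[eps --> 0^'+] --> (I s)%:E)
    (kappa : R) (kappa_gt0 : 0 < kappa)
    (kappa_lim : forall x : R, 0 < x ->
      g (x * eps) / g eps @[eps --> 0^'+] --> x `^ kappa) :
  [/\ (alpha2 kappa I <= alpha1 kappa I)%E,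
      alpha1 kappa I = alpha2 kappa I <->
        (alpha1 kappa I = (2 `^ kappa * I (1 / 2))%:E /\
         (2 `^ kappa * I (1 / 2))%:E = alpha2 kappa I)
    & kappa <= 1 ->
        (alpha1 kappa I = alpha2 kappa I <->
         alpha1 kappa I = (2 `^ kappa * I (1 / 2))%:E)].
Proof.
have g_gt0 : \forall eps \near 0^'+, 0 < g eps.
  near=> eps; have eps0 : 0 < eps by near: eps; exact: nbhs_right_gt.
  by rewrite -g0 g_incr.
have dens : \forall eps \near 0^'+,
    probability_density mu (p (theta - eps / 2)) /\
    probability_density mu (p (theta + eps / 2)).
  have /nbhs_ballP[e /= e0 sub] : nbhs theta Theta.
    by apply: open_nbhs_nbhs; split.
  near=> eps.
  have eps0 : 0 < eps by near: eps; exact: nbhs_right_gt.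
  have epse : eps < e by near: eps; exact: nbhs_right_lt.
  split; apply: p_density; apply: sub; rewrite /ball/= ltr_norml; lra.
have I0 s : 0 < s < 1 -> 0 <= I s.
  by move=> s01; exact: renyi_limit_ge0 dens g_gt0 s01 (I_lim s s01).
have cI := renyi_limit_concave dens g_gt0 I_lim.
have [le21 leH2 eq1] := alpha_comparison I0 cI kappa_gt0.
rewrite div1r; split=> //.
  split=> [a12|[-> ->]//]; have a1H := eq1 a12.
  by split=> //; rewrite -a1H.
move=> k1; split=> [|a1H]; first exact: eq1.
by apply/eqP; rewrite eq_le le21 andbT a1H leH2.
Unshelve. all: by end_near. Qed.
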